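(* Let $n\ge 2$, $c\in\mathbb{R}^n$ with $c_i>0$ for all $i$, $d\in\mathbb{R}^n$ with $d_i\ge 0$ for all $i$, and $d_0>0$. Consider the assortment game $$\nu(w)=\max_{x\in\{0,1\}^n}\left[\frac{c^Tx}{d_0+d^Tx}:\ x\le w\right],\qquad w\in\{0,1\}^n.$$ Then $\nu$ has a non-empty core if and only if the objective function is linear, i.e. $d_1=\dots=d_n=0$.
   Context: Notation: $\mathbf{1}_n$ is the all-one vector; vector inequalities are componentwise. The core of a (revenue) game $\nu:\{0,1\}^n\to\mathbb{R}$ is $\mathrm{core}(\nu)=\{y\in\mathbb{R}^n:\mathbf{1}_n^Ty=\nu(\mathbf{1}_n),\ a^Ty\ge\nu(a)\ \forall a\in\{0,1\}^n\}$. *)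

(* Defs.v *)
From HB Require Import structures.
From mathcomp Require Import all_boot all_order all_algebra.
From mathcomp Require Import boolp classical_sets reals.

Set Implicit Arguments.
Unset Strict Implicit.
Unset Printing Implicit Defensive.

Import Order.TTheory GRing.Theory Num.Theory.

Local Open Scope classical_set_scope.
Local Open Scope ring_scope.

(* The set {0,1}^n is encoded as 'cV[bool]_n (a finite type) and embedded in
   R^n, when needed, by [binvec]. *)

Definition binvec {R : realType} {n : nat} (x : 'cV[bool]_n) : 'cV[R]_n :=
  map_mx (fun b : bool => b%:R) x.

Definition dotv {R : realType} {n : nat} (u v : 'cV[R]_n) : R :=
  (u^T *m v) 0 0.

Definition ones {n : nat} : 'cV[bool]_n := const_mx true.

Definition le_bin {n : nat} (x w : 'cV[bool]_n) : bool :=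
  [forall i, (x i 0%R <= w i 0%R)%N].

Definition core {R : realType} {n : nat} (nu : 'cV[bool]_n -> R) :
    set 'cV[R]_n :=
  [set y | dotv (binvec ones) y = nu ones /\
           forall a : 'cV[bool]_n, nu a <= dotv (binvec a) y].

Definition assortment_obj {R : realType} {n : nat} (c : 'cV[R]_n) (d0 : R)
    (d : 'cV[R]_n) (x : 'cV[bool]_n) : R :=
  dotv c (binvec x) / (d0 + dotv d (binvec x)).

(* The base value of the iterated maximum is the objective at x = w, which is
   itself feasible, so this is exactly the maximum over the feasible set; see
   [assortment_game_ub] and [assortment_game_attained]. *)
Definition assortment_game {R : realType} {n : nat} (c : 'cV[R]_n) (d0 : R)
    (d : 'cV[R]_n) (w : 'cV[bool]_n) : R :=
  \big[Num.max/assortment_obj c d0 d w]_(x : 'cV[bool]_n | le_bin x w)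
    assortment_obj c d0 d x.

Lemma assortment_game_ub (R : realType) (n : nat) (c : 'cV[R]_n) (d0 : R)
    (d : 'cV[R]_n) (w x : 'cV[bool]_n) :
  le_bin x w -> assortment_obj c d0 d x <= assortment_game c d0 d w.
Proof. by move=> xw; apply: le_bigmax_cond. Qed.

Lemma assortment_game_attained (R : realType) (n : nat) (c : 'cV[R]_n)
    (d0 : R) (d : 'cV[R]_n) (w : 'cV[bool]_n) :
  exists2 x, le_bin x w & assortment_game c d0 d w = assortment_obj c d0 d x.
Proof.
rewrite /assortment_game.
apply: (big_ind (fun m => exists2 x, le_bin x w & m = assortment_obj c d0 d x)).
- by exists w => //; apply/forallP.
- by move=> _ _ [x xw ->] [y yw ->]; rewrite /Num.max; case: ifP => _;
    [exists y|exists x].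
- by move=> x xw; exists x.
Qed.

(* Main.v *)
Require Import Defs.
From HB Require Import structures.
From mathcomp Require Import all_boot all_order all_algebra.
From mathcomp Require Import boolp classical_sets reals.

Set Implicit Arguments.
Unset Strict Implicit.
Unset Printing Implicit Defensive.

Import Order.TTheory GRing.Theory Num.Theory.

Local Open Scope classical_set_scope.
Local Open Scope ring_scope.

(** If [d = 0], the game is additive and the vector [c / d0] is in the core.

    Conversely, let [y] be in the core and let [x] be an optimal assortment for
    the grand coalition.  The coalition of [i] alone can earn
    [c_i / (d0 + d_i)], which is therefore at most [y_i]; in particular
    [0 < y_i].  As [d >= 0], the share [c_i x_i / (d0 + d^T x)] of product [i]
    in the optimal revenue is at most [c_i / (d0 + d_i)], hence at most [y_i]
    ([revenue_share_le]).  The shares and the [y_i] both sum to the value of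
    the grand coalition, so they agree for every [i].  Positivity of [y_i] then
    forces [x] to be the all-one vector, and
    [c_i / (d0 + sum_j d_j) = y_i >= c_i / (d0 + d_i)] gives
    [sum_j d_j <= d_i] for every [i].  As there are at least two products, each
    [d_k] is among the terms of this sum other than [d_i], for some [i], and so
    vanishes. *)

Lemma dotvE (R : realType) (n : nat) (u v : 'cV[R]_n) :
  dotv u v = \sum_i u i 0 * v i 0.
Proof. by rewrite /dotv mxE; apply: eq_bigr => i _; rewrite mxE. Qed.

Lemma dotv_binvec (R : realType) (n : nat) (u : 'cV[R]_n) (x : 'cV[bool]_n) :
  dotv u (binvec x) = \sum_(i | x i 0) u i 0.
Proof.
rewrite dotvE [RHS]big_mkcond; apply: eq_bigr => i _; rewrite mxE.
by case: (x i 0); rewrite ?mulr1 ?mulr0.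
Qed.

Lemma dotv_binvecl (R : realType) (n : nat) (x : 'cV[bool]_n) (u : 'cV[R]_n) :
  dotv (binvec x) u = \sum_(i | x i 0) u i 0.
Proof.
by rewrite -dotv_binvec !dotvE; apply: eq_bigr => i _; rewrite mulrC.
Qed.

(** The indicator vector of the coalition consisting of [i] alone. *)
Definition singleton {n : nat} (i : 'I_n) : 'cV[bool]_n := \col_j (j == i).

Lemma dotv_singleton (R : realType) (n : nat) (u : 'cV[R]_n) (i : 'I_n) :
  dotv u (binvec (singleton i)) = u i 0.
Proof.
by rewrite dotv_binvec (eq_bigl (pred1 i)) ?big_pred1_eq // => j; rewrite mxE.
Qed.

Section AssortmentGame.
Variables (R : realType) (n : nat) (c d : 'cV[R]_n) (d0 : R).
Hypothesis c_gt0 : forall i, 0 < c i 0.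
Hypothesis d_ge0 : forall i, 0 <= d i 0.
Hypothesis d0_gt0 : 0 < d0.

Lemma core_ge_singleton (y : 'cV[R]_n) (i : 'I_n) :
  core (assortment_game c d0 d) y -> c i 0 / (d0 + d i 0) <= y i 0.
Proof.
move=> [_ /(_ (singleton i))].
rewrite dotv_binvecl -dotv_binvec dotv_singleton; apply: le_trans.
rewrite -(dotv_singleton c) -(dotv_singleton d).
by apply: assortment_game_ub; apply/forallP.
Qed.

(** In any assortment, optimal or not, each product contributes to the revenue
    at most what a core allocation gives it. *)
Lemma revenue_share_le (y : 'cV[R]_n) (x : 'cV[bool]_n) (i : 'I_n) :
  core (assortment_game c d0 d) y ->
  c i 0 * (x i 0)%:R / (d0 + dotv d (binvec x)) <= y i 0.
Proof.
move=> /(core_ge_singleton i); apply: le_trans.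
have di_gt0 : 0 < d0 + d i 0 by rewrite ltr_wpDr.
case xi: (x i 0); last by rewrite mulr0 mul0r divr_ge0 // ltW.
have di_le : d0 + d i 0 <= d0 + dotv d (binvec x).
  by rewrite lerD2l dotv_binvec (bigD1 i) //= lerDl sumr_ge0.
rewrite mulr1 ler_pM2l // lef_pV2 // posrE //.
exact: lt_le_trans di_le.
Qed.

Lemma core_sumr_d_le (y : 'cV[R]_n) (i : 'I_n) :
  core (assortment_game c d0 d) y -> \sum_j d j 0 <= d i 0.
Proof.
move=> ycore.
have [x _ nux] := assortment_game_attained c d0 d ones.
pose D := d0 + dotv d (binvec x).
have gap0 : \sum_j (y j 0 - c j 0 * (x j 0)%:R / D) = 0.
  case: (ycore) => sumy _; rewrite sumrB -mulr_suml.
  have -> : \sum_j y j 0 = dotv (binvec ones) y.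
    by rewrite dotv_binvecl; apply: eq_bigl => j; rewrite mxE.
  have -> : \sum_j c j 0 * (x j 0)%:R = dotv c (binvec x).
    by rewrite dotvE; apply: eq_bigr => j _; rewrite mxE.
  by rewrite sumy nux subrr.
have share j : y j 0 = c j 0 * (x j 0)%:R / D.
  apply/subr0_eq/(psumr_eq0P _ gap0) => // k _.
  by rewrite subr_ge0 revenue_share_le.
have alone_gt0 j : 0 < d0 + d j 0 by rewrite ltr_wpDr.
have x1 j : x j 0.
  have : 0 < y j 0.
    by apply: lt_le_trans (core_ge_singleton j ycore); rewrite divr_gt0.
  by rewrite share; case: (x j 0) => //; rewrite mulr0 mul0r ltxx.
have DE : D = d0 + \sum_j d j 0.
  by rewrite /D dotv_binvec; congr (_ + _); apply: eq_bigl.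
have D_gt0 : 0 < D by rewrite DE ltr_wpDr // sumr_ge0.
have := core_ge_singleton i ycore.
by rewrite share x1 mulr1 ler_pM2l // lef_pV2 ?posrE // DE lerD2l.
Qed.

Lemma core_linear :
  (forall i, d i 0 = 0) ->
  core (assortment_game c d0 d) (\col_i (c i 0 / d0)).
Proof.
move=> d_eq0.
have dotd0 x : dotv d (binvec x) = 0 by rewrite dotv_binvec big1.
have doty x : dotv (binvec x) (\col_i (c i 0 / d0)) = assortment_obj c d0 d x.
  rewrite /assortment_obj dotd0 addr0 dotv_binvecl dotv_binvec mulr_suml.
  by apply: eq_bigr => i _; rewrite mxE.
(* A linear objective with positive coefficients is monotone, so selling all
   of [w] is optimal for [w]. *)
have game_le w : assortment_game c d0 d w <= assortment_obj c d0 d w.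
  have [x /forallP xw ->] := assortment_game_attained c d0 d w.
  rewrite /assortment_obj !dotd0 addr0 ler_pM2r ?invr_gt0 // !dotvE.
  apply: ler_sum => i _; rewrite !mxE ler_pM2l // ler_nat.
  exact: xw.
split=> [|w]; last by rewrite doty.
rewrite doty; apply: le_anti; rewrite game_le andbT.
by apply: assortment_game_ub; apply/forallP.
Qed.

End AssortmentGame.

Theorem proposition6 (R : realType) (n : nat) (c d : 'cV[R]_n) (d0 : R)
    (hn : (2 <= n)%N) (hc : forall i : 'I_n, 0 < c i 0)
    (hd : forall i : 'I_n, 0 <= d i 0) (hd0 : 0 < d0) :
  core (assortment_game c d0 d) !=set0 <-> (forall i : 'I_n, d i 0 = 0).
Proof.
split=> [[y ycore] k|d_eq0]; last first.
  by exists (\col_i (c i 0 / d0)); apply: core_linear.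
have [i ik] : exists i : 'I_n, k != i.
  have /card_gt0P[i] : (0 < #|predC1 k|)%N
    by rewrite cardC1 card_ord -subn1 subn_gt0.
  by rewrite inE eq_sym; exists i.
have := core_sumr_d_le hc hd hd0 i ycore.
rewrite (bigD1 i) //= gerDl (bigD1 k) //= => sum_le0.
apply: le_anti; rewrite hd andbT; apply: le_trans sum_le0.
by rewrite lerDl sumr_ge0.
Qed.
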